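(* Let $n\ge2$ and let $GM^*(n):=\text{Möb}(n)\times\{\mathbf I,-\mathbf I\}$. There is a unique isomorphism $\pi:GM^*(n)\to\mathrm{Aut}(Q_{W,n})$, with image elements written $\mathbf V_{\pm\mathfrak g}:=\pi(\pm\mathfrak g)$ for $\mathfrak g\in\text{Möb}(n)$, such that the following hold. (i) For every $\mathfrak g\in\text{Möb}(n)$ and every ordered, oriented Descartes configuration $\mathcal D$ in $\mathbb R^n$, the augmented curvature-center coordinates satisfy $$\mathbf W_{\mathfrak g(\mathcal D)}=\mathbf W_{\mathcal D}\,\mathbf V_{\mathfrak g}^{-1}.$$ (ii) The action of $-\mathbf I$ on augmented curvature-center coordinates is $$\mathbf W_{-\mathcal D}=\mathbf W_{\mathcal D}\mathbf V_{-\mathbf I}^{-1}=-\mathbf W_{\mathcal D},$$ which reverses the orientation of the Descartes configuration (here $-\mathcal D$ denotes $\mathcal D$ with the orientations of all its spheres reversed).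
   Context: $\text{Möb}(n)$ is the (general) Möbius group, generated by reflections (inversions) in spheres and hyperplanes, acting on the one-point compactification $\hat{\mathbb R}^n=\mathbb R^n\cup\{\infty\}$. $\{\mathbf I,-\mathbf I\}$ is a group of order two; elements of $GM^*(n)$ are written $\pm\mathfrak g$ with $\mathfrak g\in\text{Möb}(n)$, the sign indicating the second component. $\mathbf{Q}_{W,n}=\begin{pmatrix}0&-4&0\\-4&0&0\\0&0&2\mathbf{I}_n\end{pmatrix}$ and $\mathrm{Aut}(Q_{W,n})=\{\mathbf V\in GL(n+2,\mathbb R):\mathbf V^T\mathbf Q_{W,n}\mathbf V=\mathbf Q_{W,n}\}$. ''Sphere'' means an $(n-1)$-sphere in $\mathbb R^n$, hyperplanes being allowed as degenerate spheres (passing through $\infty$). An oriented sphere is a sphere with a chosen direction of unit normal; its signed curvature is $b=1/r$ for the inward normal and $b=-1/r$ for the outward normal ($r$ the radius), and its interior is the usual interior for the inward normal and the exterior for the outward normal. An oriented hyperplane has signed curvature $0$ and its interior is the open half-space into which its chosen unit normal points. A Möbius transformation maps oriented spheres to oriented spheres, carrying interior to interior. A Descartes configuration in $\mathbb R^n$ consists of $n+2$ pairwise tangent spheres with all points of tangency distinct (parallel hyperplanes are tangent at $\infty$). It is oriented if its spheres are oriented so that either the interiors of all $n+2$ oriented spheres are pairwise disjoint, or they are pairwise disjoint after reversing all orientations. For $\mathcal D=(S_1,\dots,S_{n+2})$, $\mathfrak g(\mathcal D)=(\mathfrak g(S_1),\dots,\mathfrak g(S_{n+2}))$. The augmented curvature-center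 coordinates of an oriented sphere with signed curvature $b\neq0$ and center $\mathbf x=(x_1,\dots,x_n)$ are the row vector $(\bar b,b,bx_1,\dots,bx_n)$ with $\bar b=b|\mathbf x|^2-1/b$ (the signed curvature of its image under inversion in the unit sphere); for an oriented hyperplane $\{\mathbf y:\mathbf y\cdot\mathbf h=m\}$ with unit normal $\mathbf h$ they are $(2m,0,h_1,\dots,h_n)$. For an ordered, oriented Descartes configuration $\mathcal D$, $\mathbf W_{\mathcal D}$ is the $(n+2)\times(n+2)$ matrix whose $j$-th row is the coordinate vector of its $j$-th sphere. Known fact: $\mathcal D\mapsto\mathbf W_{\mathcal D}$ is a bijection from ordered, oriented Descartes configurations onto the real matrices $\mathbf W$ with $\mathbf W^T\mathbf Q_{D,n}\mathbf W=\mathbf Q_{W,n}$, where $\mathbf{Q}_{D,n}=\mathbf{I}_{n+2}-\frac1n\mathbf{1}\mathbf{1}^T$ and $\mathbf 1=(1,\dots,1)^T$. *)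

(* Defs.v *)
From HB Require Import structures.
From mathcomp Require Import all_boot all_order all_algebra.
From mathcomp Require Import all_classical all_reals all_analysis.
From mathcomp Require Import ring lra.
Import Order.TTheory GRing.Theory Num.Theory.
Import numFieldNormedType.Exports.

Set Implicit Arguments.
Unset Strict Implicit.
Unset Printing Implicit Defensive.

Local Open Scope classical_set_scope.
Local Open Scope ring_scope.

Section SymmetricGroup.
Variable T : Type.

Record bijection := Bijection {
  bij_fun :> T -> T;
  bij_inv : T -> T;
  bij_funK : cancel bij_fun bij_inv;
  bij_invK : cancel bij_inv bij_fun }.

Lemma bijection_eq (f g : bijection) : f =1 g -> f = g.
Proof.
move: f g => [f f' fK f'K] [g g' gK g'K] /= fg.
have {fg}efg : f = g by exact/funext.
move: fK f'K; rewrite efg => fK f'K.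
have efg' : f' = g' by apply/funext => x; rewrite -{1}(g'K x) fK.
move: fK f'K; rewrite efg' => fK f'K.
by congr Bijection; exact: Prop_irrelevance.
Qed.

HB.instance Definition _ := gen_eqMixin bijection.
HB.instance Definition _ := gen_choiceMixin bijection.

Definition bijection1 : bijection := @Bijection id id (frefl _) (frefl _).

Definition bijectionM (f g : bijection) : bijection :=
  Bijection (can_comp (@bij_funK f) (@bij_funK g))
            (can_comp (@bij_invK g) (@bij_invK f)).

Definition bijectionV (f : bijection) : bijection :=
  Bijection (@bij_invK f) (@bij_funK f).

Fact bijectionMA : associative bijectionM.
Proof. by move=> f g h; exact: bijection_eq. Qed.
Fact bijection1M : left_id bijection1 bijectionM.
Proof. by move=> f; exact: bijection_eq. Qed.
Fact bijectionM1 : right_id bijection1 bijectionM.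
Proof. by move=> f; exact: bijection_eq. Qed.
Fact bijectionVM : left_inverse bijection1 bijectionV bijectionM.
Proof. by move=> f; apply: bijection_eq => x /=; rewrite bij_funK. Qed.
Fact bijectionMV : right_inverse bijection1 bijectionV bijectionM.
Proof. by move=> f; apply: bijection_eq => x /=; rewrite bij_invK. Qed.

HB.instance Definition _ := isGroup.Build bijection
  bijectionMA bijection1M bijectionM1 bijectionVM bijectionMV.

End SymmetricGroup.

Inductive generated (G : groupType) (A : set G) : G -> Prop :=
| generated_mem x : A x -> generated A x
| generated1 : generated A 1%g
| generatedM x y : generated A x -> generated A y -> generated A (x * y)%g
| generatedV x : generated A x -> generated A x^-1%g.

(* ['GL_m[R]] of the library requires [R] finite. *)
Section GeneralLinear.
Variables (R : comUnitRingType) (m : nat).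

Record GL := MkGL { GLmx :> 'M[R]_m; GLmx_unit : GLmx \in unitmx }.

HB.instance Definition _ := [isSub for GLmx].
HB.instance Definition _ := [Choice of GL by <:].

Fact GL1_subproof : (1%:M : 'M[R]_m) \in unitmx.
Proof. exact: unitmx1. Qed.
Fact GLM_subproof (A B : GL) : A *m B \in unitmx.
Proof. by rewrite unitmx_mul !GLmx_unit. Qed.
Fact GLV_subproof (A : GL) : invmx A \in unitmx.
Proof. by rewrite unitmx_inv GLmx_unit. Qed.

Definition GL1 := MkGL GL1_subproof.
Definition GLM (A B : GL) := MkGL (GLM_subproof A B).
Definition GLV (A : GL) := MkGL (GLV_subproof A).

Fact GLMA : associative GLM.
Proof. by move=> A B C; apply: val_inj; exact: mulmxA. Qed.
Fact GL1M : left_id GL1 GLM.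
Proof. by move=> A; apply: val_inj; exact: mul1mx. Qed.
Fact GLM1 : right_id GL1 GLM.
Proof. by move=> A; apply: val_inj; exact: mulmx1. Qed.
Fact GLVM : left_inverse GL1 GLV GLM.
Proof. by move=> A; apply: val_inj; apply: mulVmx; exact: GLmx_unit. Qed.
Fact GLMV : right_inverse GL1 GLV GLM.
Proof. by move=> A; apply: val_inj; apply: mulmxV; exact: GLmx_unit. Qed.

HB.instance Definition _ := isGroup.Build GL GLMA GL1M GLM1 GLVM GLMV.

End GeneralLinear.

Section AutQW.
Variables (R : realType) (n : nat).

Definition QW : 'M[R]_n.+2 :=
  block_mx (\matrix_(i < 2, j < 2) if i == j then 0 else -4) 0
           0 (2%:M : 'M[R]_n).

Definition preserves_QW : pred (GL R n.+2) :=
  fun V => V^T *m QW *m V == QW.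

Fact preserves_QW_closed : group_closed preserves_QW.
Proof.
split => [|A B]; rewrite !unfold_in.
  by rewrite /= trmx1 mul1mx mulmx1.
move=> /eqP hA /eqP hB; apply/eqP => /=.
have hB' : (invmx B)^T *m QW *m invmx B = QW.
  rewrite -[in LHS]hB !mulmxA -trmx_mul mulmxV ?GLmx_unit// trmx1 mul1mx.
  by rewrite -mulmxA mulmxV ?GLmx_unit// mulmx1.
by rewrite trmx_mul -!mulmxA (mulmxA A^T) (mulmxA (A^T *m QW)) hA mulmxA.
Qed.

Record AutQW := MkAutQW { AutQW_GL :> GL R n.+2; _ : preserves_QW AutQW_GL }.

HB.instance Definition _ := [isSub for AutQW_GL].
HB.instance Definition _ := [Choice of AutQW by <:].
HB.instance Definition _ :=
  SubChoice_isSubGroup.Build _ _ AutQW preserves_QW_closed.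

End AutQW.

Section PlusMinus.
Variables (R : realType) (n : nat).

Definition is_pmI : pred (GL R n.+2) :=
  fun A => (GLmx A == 1%:M) || (GLmx A == - 1%:M).

Fact is_pmI_closed : group_closed is_pmI.
Proof.
have invN1 : invmx (- 1%:M : 'M[R]_n.+2) = - 1%:M.
  have u : (- 1%:M : 'M[R]_n.+2) \in unitmx.
    by rewrite -scaleN1r unitmxZ ?unitrN ?unitr1 ?unitmx1.
  apply: (can_inj (mulKmx u)).
  by rewrite mulmxV// mulNmx mul1mx opprK.
split => [|A B]; rewrite !unfold_in; first by rewrite eqxx.
move=> /orP[] /eqP hA /orP[] /eqP hB /=;
  by rewrite hA hB ?invN1 ?invmx1 ?mul1mx ?mulNmx ?mulmxN ?mul1mx ?opprK eqxx ?orbT.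
Qed.

Record pmI := MkPmI { pmI_GL :> GL R n.+2; _ : is_pmI pmI_GL }.

HB.instance Definition _ := [isSub for pmI_GL].
HB.instance Definition _ := [Choice of pmI by <:].
HB.instance Definition _ := SubChoice_isSubGroup.Build _ _ pmI is_pmI_closed.

Fact negI_unit : (- 1%:M : 'M[R]_n.+2) \in unitmx.
Proof. by rewrite -scaleN1r unitmxZ ?unitrN ?unitr1 ?unitmx1. Qed.
Fact negI_subproof : is_pmI (MkGL negI_unit).
Proof. by rewrite /is_pmI eqxx orbT. Qed.
Definition negI : pmI := MkPmI negI_subproof.

End PlusMinus.

Arguments negI {R n}.

Section OrientedSpheres.
Variables (R : realType) (n : nat).

(* The norm which the library puts on row vectors is the sup norm. *)
Definition dot (u v : 'rV[R]_n) : R := \sum_(i < n) u 0 i * v 0 i.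
Definition enorm (u : 'rV[R]_n) : R := Num.sqrt (dot u u).

Lemma dotC u v : dot u v = dot v u.
Proof. by apply: eq_bigr => i _; rewrite mulrC. Qed.
Lemma dotDl u v w : dot (u + v) w = dot u w + dot v w.
Proof. by rewrite -big_split; apply: eq_bigr => i _; rewrite mxE mulrDl. Qed.
Lemma dotZl a u w : dot (a *: u) w = a * dot u w.
Proof. by rewrite mulr_sumr; apply: eq_bigr => i _; rewrite mxE mulrA. Qed.
Lemma dotNl u w : dot (- u) w = - dot u w.
Proof. by rewrite -scaleN1r dotZl mulN1r. Qed.
Lemma dotNr u w : dot u (- w) = - dot u w.
Proof. by rewrite dotC dotNl dotC. Qed.
Lemma dot_ge0 u : 0 <= dot u u.
Proof. by apply: sumr_ge0 => i _; rewrite -expr2 sqr_ge0. Qed.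
Lemma dot_eq0 u : (dot u u == 0) = (u == 0).
Proof.
apply/idP/eqP => [|->]; last by rewrite /dot big1// => i _; rewrite mxE mul0r.
rewrite psumr_eq0 => [/allP h|i _]; last by rewrite -expr2 sqr_ge0.
apply/rowP => i; rewrite mxE; apply/eqP.
by have := h i (mem_index_enum i); rewrite -expr2 sqrf_eq0.
Qed.
Lemma enorm_sqr u : enorm u ^+ 2 = dot u u.
Proof. by rewrite sqr_sqrtr// dot_ge0. Qed.

Record unit_vector := UnitVector
  { uvec :> 'rV[R]_n; uvec_norm : enorm uvec = 1 }.

Fact opp_unit_vector_subproof (h : unit_vector) : enorm (- (h : 'rV[R]_n)) = 1.
Proof. by rewrite /enorm dotNl dotNr opprK; exact: uvec_norm. Qed.
Definition opp_unit_vector h := UnitVector (opp_unit_vector_subproof h).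

Variant orientation := Inward | Outward.

(* [OHyperplane h m] is the hyperplane [y . h = m] oriented by its unit
   normal [h]: [OHyperplane h m] and [OHyperplane (-h) (-m)] are the two
   orientations of a single hyperplane. *)
Variant osphere :=
| OSphere of 'rV[R]_n & {posnum R} & orientation
| OHyperplane of unit_vector & R.

HB.instance Definition _ := gen_eqMixin osphere.
HB.instance Definition _ := gen_choiceMixin osphere.

Definition osphere_opp (S : osphere) : osphere :=
  match S with
  | OSphere c r Inward => OSphere c r Outward
  | OSphere c r Outward => OSphere c r Inward
  | OHyperplane h m => OHyperplane (opp_unit_vector h) (- m)
  end.

Definition Rhat := one_point_compactification 'rV[R]_n.
Definition pt (x : 'rV[R]_n) : Rhat := Some x.
Definition infty : Rhat := None.

Definition support (S : osphere) : set Rhat :=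
  match S with
  | OSphere c r _ => pt @` [set y | enorm (y - c) = r%:num]
  | OHyperplane h m => infty |` (pt @` [set y | dot y h = m])
  end.

(* The exterior of a sphere contains the point at infinity, so that Moebius
   transformations carry interiors to interiors. *)
Definition ointerior (S : osphere) : set Rhat :=
  match S with
  | OSphere c r Inward => pt @` [set y | enorm (y - c) < r%:num]
  | OSphere c r Outward => infty |` (pt @` [set y | r%:num < enorm (y - c)])
  | OHyperplane h m => pt @` [set y | m < dot y h]
  end.

Definition reflection_fun (S : osphere) (x : Rhat) : Rhat :=
  match S, x with
  | OSphere c r _, Some y =>
      if y == c then infty
      else pt (c + (r%:num ^+ 2 / enorm (y - c) ^+ 2) *: (y - c))
  | OSphere c r _, None => pt c
  | OHyperplane h m, Some y =>
      pt (y - (2 * (dot y h - m)) *: (h : 'rV[R]_n))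
  | OHyperplane h m, None => infty
  end.

Lemma reflection_funK S : involutive (reflection_fun S).
Proof.
case: S => [c r o|h m] [y|] //=; first 1 last.
- by rewrite eqxx.
- congr Some; have hh : dot h h = 1 by rewrite -enorm_sqr uvec_norm expr1n.
  rewrite dotDl dotNl dotZl hh -addrA -opprD -scalerDl.
  set t := (X in X *: _); suff -> : t = 0 by rewrite scale0r oppr0 addr0.
  by rewrite /t; ring.
- case: (eqVneq y c) => [->//|yc] /=.
  have yc0 : y - c != 0 by rewrite subr_eq0.
  have d0 : dot (y - c) (y - c) != 0 by rewrite dot_eq0.
  have r0 : r%:num ^+ 2 != 0 :> R by rewrite expf_neq0// gt_eqF.
  set k := _ / _.
  have k0 : k != 0 by rewrite mulf_neq0// ?invr_eq0 enorm_sqr.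
  have -> : (c + k *: (y - c) == c) = false.
    by rewrite -subr_eq0 addrC addKr scaler_eq0 (negbTE k0) (negbTE yc0).
  congr Some; rewrite [c + _ - c]addrC addKr.
  rewrite enorm_sqr dotZl dotC dotZl scalerA.
  have -> : r%:num ^+ 2 / (k * (k * dot (y - c) (y - c))) * k = 1.
    rewrite /k enorm_sqr; field; first by rewrite d0 gt_eqF.
  by rewrite scale1r addrC subrK.
Qed.

Definition reflection (S : osphere) : bijection Rhat :=
  Bijection (reflection_funK S) (reflection_funK S).

Definition is_mobius : pred (bijection Rhat) :=
  fun g => `[< generated (range reflection) g >].

Fact is_mobius_closed : group_closed is_mobius.
Proof.
split => [|f g]; rewrite !unfold_in; first exact/asboolP/generated1.
move=> /asboolP hf /asboolP hg; apply/asboolP.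
by apply: generatedM => //; exact: generatedV.
Qed.

Record mobius := MkMobius
  { mobius_bij :> bijection Rhat; _ : is_mobius mobius_bij }.

HB.instance Definition _ := [isSub for mobius_bij].
HB.instance Definition _ := [Choice of mobius by <:].
HB.instance Definition _ :=
  SubChoice_isSubGroup.Build _ _ mobius is_mobius_closed.

Definition GMstar : groupType := (mobius * pmI R n)%type.

(* A support and an interior belong to at most one oriented sphere, and the
   images of those of [S] under a Moebius transformation do belong to one, so
   the default value [S] of the choice operator is not used. *)
Definition osphere_image (g : mobius) (S : osphere) : osphere :=
  xget S [set T | support T = g @` support S /\
                  ointerior T = g @` ointerior S].

Definition tangent_at (S T : osphere) (p : Rhat) : Prop :=
  support S `&` support T = [set p].

Definition interiors_disjoint (D : 'I_n.+2 -> osphere) : Prop :=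
  forall i j, i != j -> ointerior (D i) `&` ointerior (D j) = set0.

Definition oriented_descartes (D : 'I_n.+2 -> osphere) : Prop :=
  [/\ forall i j, i != j -> exists p, tangent_at (D i) (D j) p,
      forall (i j k l : 'I_n.+2) (p : Rhat), (i < j)%N -> (k < l)%N ->
        tangent_at (D i) (D j) p -> tangent_at (D k) (D l) p ->
        (i, j) = (k, l)
    & interiors_disjoint D \/ interiors_disjoint (osphere_opp \o D)].

Definition signed_curvature (S : osphere) : R :=
  match S with
  | OSphere _ r Inward => r%:num^-1
  | OSphere _ r Outward => - r%:num^-1
  | OHyperplane _ _ => 0
  end.

Definition acc_coords (S : osphere) : 'rV[R]_n.+2 :=
  let b := signed_curvature S in
  match S with
  | OSphere x _ _ =>
      row_mx (\row_(i < 2) [:: b * enorm x ^+ 2 - b^-1; b]`_i) (b *: x)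
  | OHyperplane h m =>
      row_mx (\row_(i < 2) [:: 2 * m; 0]`_i) (h : 'rV[R]_n)
  end.

Definition W (D : 'I_n.+2 -> osphere) : 'M[R]_n.+2 :=
  \matrix_(j < n.+2) acc_coords (D j).

End OrientedSpheres.

(* Main.v *)
(* Send an oriented sphere to its augmented curvature-center row w and a point x
   to the row (|x|^2, 1, x), and infinity to (1, 0, 0). For the Lorentz form
   q = |h|^2 - a b on rows (a, b, h), whose Gram matrix is 2 Q_W^-1, the spheres
   are the vectors with q = 1 and the points are the rays of the future light
   cone; a point is on (inside) a sphere iff its q-product with w vanishes (is
   positive). Inversion in the sphere w acts on rays as the q-reflection
   u - 2 q(u, w) w, so each Moebius map g acts as a linear isometry V_g, and then
   also on spheres. Conversely an isometry preserving the direction of time is a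
   product of such reflections: first move a time vector back to itself, then
   successively the standard basis vectors, as in the Cartan-Dieudonne theorem.
   Uniqueness follows from a Descartes configuration with invertible W. *)
Require Import Defs.
From mathcomp Require Import all_boot all_order all_algebra.
From mathcomp Require Import all_classical all_reals all_analysis.
From mathcomp Require Import ring lra.
Import Order.TTheory GRing.Theory Num.Theory.

Set Implicit Arguments.
Unset Strict Implicit.
Unset Printing Implicit Defensive.

Local Open Scope ring_scope.

(** * The Lorentz form on coordinate rows, with [AutQW] as its isometry group *)

Section LorentzForm.
Variables (R : realType) (n : nat).
Implicit Types (a b : R) (h x : 'rV[R]_n) (u v w : 'rV[R]_n.+2).

(** Built exactly like the rows in [acc_coords], so that these are of the form [vec] by
    conversion. *)
Definition vec a b h : 'rV[R]_n.+2 :=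
  row_mx (\row_(i < 2) [:: a; b]`_i) h : 'rV_(2 + n).

Lemma vecP u : exists a b h, u = vec a b h.
Proof.
exists ((u : 'rV_(2 + n)) 0 (lshift n 0)), ((u : 'rV_(2 + n)) 0 (lshift n 1)).
exists (rsubmx (u : 'rV_(2 + n))); rewrite /vec.
rewrite -[LHS](hsubmxK (u : 'rV_(2 + n))); apply: (congr2 (@row_mx R 1 2 n)) => //.
by apply/rowP => -[[|[|//]] p]; rewrite !mxE /=; congr (u 0 _); apply/val_inj.
Qed.

Lemma vec_inj a b h a' b' h' :
  vec a b h = vec a' b' h' -> [/\ a = a', b = b' & h = h'].
Proof.
move=> e0; have [e ->] := @eq_row_mx R 1 2 n _ _ _ _ e0; split=> //.
  by have := congr1 (fun r : 'rV_2 => r 0 0) e; rewrite !mxE.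
by have := congr1 (fun r : 'rV_2 => r 0 1) e; rewrite !mxE.
Qed.

Lemma vecD a b h a' b' h' :
  vec a b h + vec a' b' h' = vec (a + a') (b + b') (h + h').
Proof.
rewrite /vec; etransitivity; first exact: (@add_row_mx R 1 2 n).
by apply: (congr2 (@row_mx R 1 2 n)) => //; apply/rowP => -[[|[|//]] p]; rewrite !mxE.
Qed.

Lemma vecZ k a b h : k *: vec a b h = vec (k * a) (k * b) (k *: h).
Proof.
rewrite /vec; etransitivity; first exact: (@scale_row_mx R 1 2 n).
by apply: (congr2 (@row_mx R 1 2 n)) => //; apply/rowP => -[[|[|//]] p]; rewrite !mxE.
Qed.

Lemma vecN a b h : - vec a b h = vec (- a) (- b) (- h).
Proof. by rewrite -scaleN1r vecZ !mulN1r scaleN1r. Qed.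

Lemma vec0 : vec 0 0 0 = 0.
Proof. by rewrite -[RHS](scale0r (vec 0 0 0)) vecZ !mul0r scale0r. Qed.

(** Twice the inverse of [QW]: rows are multiplied by [V] on the right, so the form that they
    preserve is the dual one. *)
Definition gram : 'M[R]_n.+2 :=
  block_mx (\matrix_(i < 2, j < 2) if i == j then 0 else - 2^-1) 0
           0 (1%:M : 'M[R]_n).

Definition bform u v : R := (u *m gram *m v^T) 0 0.

Lemma mulmx_vec_block a b h k (N : 'M[R]_n) :
  vec a b h *m
    (block_mx (\matrix_(i < 2, j < 2) if i == j then 0 else k) 0 0 N
      : 'M[R]_(2 + n)) = vec (k * b) (k * a) (h *m N).
Proof.
rewrite /vec; etransitivity; first exact: (@mul_row_block R 1 2 n 2 n).
rewrite !mulmx0 addr0 add0r; apply: (congr2 (@row_mx R 1 2 n)) => //.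
apply/rowP => -[[|[|//]] p]; rewrite !mxE !big_ord_recl big_ord0 !mxE /=.
  by rewrite mulr0 add0r addr0 mulrC.
by rewrite mulr0 addr0 addr0 mulrC.
Qed.

Lemma vec_mul_tr a b h a' b' h' :
  (vec a b h *m (vec a' b' h')^T) 0 0 = a * a' + b * b' + dot h h'.
Proof.
rewrite mxE (@big_split_ord _ _ _ 2 n) /=; congr (_ + _).
  have E (i : 'I_2) (j := lshift n i : 'I_(2 + n)) :
      vec a b h 0 j * (vec a' b' h')^T j 0 = [:: a; b]`_i * [:: a'; b']`_i.
    by rewrite [X in _ * X]mxE !(@row_mxEl _ 1 2 n) !mxE.
  by rewrite (eq_bigr _ (fun i _ => E i)) !big_ord_recl big_ord0 addr0.
apply: eq_bigr => i _.
by rewrite (@row_mxEr _ 1 2 n) mxE (@row_mxEr _ 1 2 n).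
Qed.

Lemma bform_vec a b h a' b' h' :
  bform (vec a b h) (vec a' b' h') = dot h h' - (a * b' + b * a') / 2.
Proof.
by rewrite /bform /gram mulmx_vec_block vec_mul_tr mulmx1; field.
Qed.

Lemma bformC u v : bform u v = bform v u.
Proof.
have [a [b [h ->]]] := vecP u; have [a' [b' [h' ->]]] := vecP v.
by rewrite !bform_vec dotC; ring.
Qed.

Lemma bformDl u v w : bform (u + v) w = bform u w + bform v w.
Proof. by rewrite /bform !mulmxDl mxE. Qed.
Lemma bformZl k u w : bform (k *: u) w = k * bform u w.
Proof. by rewrite /bform -!scalemxAl mxE. Qed.
Lemma bformNl u w : bform (- u) w = - bform u w.
Proof. by rewrite -scaleN1r bformZl mulN1r. Qed.
Lemma bformDr u v w : bform w (u + v) = bform w u + bform w v.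
Proof. by rewrite ![bform w _]bformC bformDl. Qed.
Lemma bformZr k u w : bform w (k *: u) = k * bform w u.
Proof. by rewrite ![bform w _]bformC bformZl. Qed.
Lemma bformNr u w : bform w (- u) = - bform w u.
Proof. by rewrite ![bform w _]bformC bformNl. Qed.

Lemma gram_QW : gram *m QW R n = 2%:M.
Proof.
apply/row_matrixP => i; rewrite !rowE mulmxA.
have [a [b [h ->]]] := vecP (delta_mx 0 i).
rewrite /gram mulmx_vec_block mulmx1 /QW mulmx_vec_block.
by rewrite !mul_mx_scalar vecZ; congr vec; field.
Qed.

Lemma bform_mx_eq (A B : 'M[R]_n.+2) :
  (forall u v, (u *m A *m v^T) 0 0 = (u *m B *m v^T) 0 0) -> A = B.
Proof.
move=> AB; apply/matrixP => i j.
have := AB (delta_mx 0 i) (delta_mx 0 j).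
by rewrite trmx_delta -!rowE -!colE !mxE.
Qed.

Lemma gram_unit : gram \in unitmx.
Proof.
have : gram *m (2^-1 *: QW R n) = 1%:M.
  by rewrite -scalemxAr gram_QW scale_scalar_mx mulVf// pnatr_eq0.
by move=> /mulmx1_unit[].
Qed.

Lemma QW_gram : QW R n = 2 *: invmx gram.
Proof.
apply: (can_inj (mulKmx gram_unit)).
by rewrite gram_QW -scalemxAr mulmxV ?gram_unit// scalemx1.
Qed.

(** Since [QW] is twice the inverse of [gram], each equation says that [gram *m V^T *m invmx gram]
    is a one-sided inverse of [V], on the left or on the right; for square matrices the two
    agree. *)
Lemma preserves_gram (V : 'M[R]_n.+2) :
  (V^T *m QW R n *m V = QW R n) <-> (V *m gram *m V^T = gram).
Proof.
have two0 : (2 : R) != 0 by rewrite pnatr_eq0.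
rewrite QW_gram -scalemxAr -scalemxAl; split=> [/(scalerI two0) e|e].
  have /mulmx1C : (gram *m V^T *m invmx gram) *m V = 1%:M.
    by rewrite -!mulmxA (mulmxA V^T) e mulmxV// gram_unit.
  by rewrite !mulmxA => /(congr1 (mulmx^~ gram)); rewrite mulmxKV ?gram_unit// mul1mx.
congr (_ *: _); have /mulmx1C : V *m (gram *m V^T *m invmx gram) = 1%:M.
  by rewrite !mulmxA e mulmxV// gram_unit.
rewrite -!mulmxA => /(congr1 (mulmx (invmx gram))).
by rewrite mulKmx ?gram_unit// mulmx1 mulmxA.
Qed.

Lemma AutQW_bform (V : AutQW R n) u v : bform (u *m V) (v *m V) = bform u v.
Proof.
have /eqP/preserves_gram e := valP V.
by rewrite /bform trmx_mul -!mulmxA (mulmxA gram) (mulmxA V) (mulmxA V) e.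
Qed.

Lemma isometry_AutQW (V : 'M[R]_n.+2) :
  (forall u v, bform (u *m V) (v *m V) = bform u v) ->
  exists A : AutQW R n, A = V :> 'M[R]_n.+2.
Proof.
move=> h; have e : V *m gram *m V^T = gram.
  by apply: bform_mx_eq => u v; rewrite -[RHS]h /bform trmx_mul !mulmxA.
have uV : V \in unitmx.
  have := gram_unit; rewrite -{1}e -mulmxA unitmx_mul => /andP[//].
have p : preserves_QW (MkGL uV) by apply/eqP/preserves_gram.
by exists (MkAutQW p).
Qed.

End LorentzForm.

(** * Oriented spheres as unit vectors, points as light rays *)

Section SpheresAsVectors.
Variables (R : realType) (n : nat).
Implicit Types (a b : R) (c h y : 'rV[R]_n) (u v w : 'rV[R]_n.+2).
Implicit Types (S T : osphere R n) (x : Rhat R n).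

Lemma dotDr c h y : dot c (h + y) = dot c h + dot c y.
Proof. by rewrite dotC dotDl !(dotC c). Qed.
Lemma dotZr a c h : dot c (a *: h) = a * dot c h.
Proof. by rewrite dotC dotZl (dotC c). Qed.
Lemma dot0l h : dot 0 h = 0.
Proof. by rewrite -(scale0r h) dotZl mul0r. Qed.
Lemma dot0r h : dot h 0 = 0.
Proof. by rewrite dotC dot0l. Qed.
Lemma dotBB c y : dot (y - c) (y - c) = dot y y - 2 * dot y c + dot c c.
Proof. by rewrite dotDl !dotDr !dotNl !dotNr (dotC c y); ring. Qed.

Lemma dotDD c y : dot (c + y) (c + y) = dot c c + 2 * dot c y + dot y y.
Proof. by rewrite dotDl !dotDr (dotC y c); ring. Qed.

Lemma unit_vector_dot (h : unit_vector R n) : dot h h = 1.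
Proof. by rewrite -enorm_sqr uvec_norm expr1n. Qed.

Definition light x : 'rV[R]_n.+2 :=
  if x is Some y then vec (dot y y) 1 y else vec 1 0 0.

Lemma light_bform_ff y y' :
  bform (light (Some y)) (light (Some y')) = - dot (y - y') (y - y') / 2.
Proof. by rewrite bform_vec dotBB; field. Qed.

Lemma light_bform x : bform (light x) (light x) = 0.
Proof.
case: x => [y|]; first by rewrite light_bform_ff subrr dot0l oppr0 mul0r.
by rewrite bform_vec dot0l; ring.
Qed.

(** The product is minus half the squared distance for two finite points, and -1/2 if one of them is
    infinity. *)
Lemma light_bform_lt0 x x' : x <> x' -> bform (light x) (light x') < 0.
Proof.
case: x x' => [y|] [y'|] // xx'.
- rewrite light_bform_ff; have : dot (y - y') (y - y') != 0.
    by rewrite dot_eq0 subr_eq0; apply/eqP => e; apply: xx'; rewrite e.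
  by have := dot_ge0 (y - y'); rewrite le_eqVlt eq_sym => /orP[->//|]; lra.
- by rewrite bform_vec dot0r; lra.
- by rewrite bform_vec dot0l; lra.
Qed.

Lemma light_inj k x x' : k *: light x = light x' -> x = x'.
Proof.
move=> e; apply: contrapT => /light_bform_lt0.
by rewrite -e bformZr light_bform mulr0 ltxx.
Qed.

Lemma lightlike_light a b h : dot h h = a * b -> 0 < a + b ->
  exists2 k, 0 < k & exists x, vec a b h = k *: light x.
Proof.
move=> hh ab; have [b0|b0] := eqVneq b 0.
  exists a; first by lra.
  exists None => /=; rewrite vecZ mulr1 mulr0 scaler0 b0.
  by move: hh; rewrite b0 mulr0 => /eqP; rewrite dot_eq0 => /eqP ->.
(* As [a * b] is a square norm, [b < 0] would force [a <= 0], against [0 < a + b]. *)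
have bp : 0 < b.
  have := dot_ge0 h; rewrite hh; have := sqr_ge0 b.
  have : b < 0 \/ 0 < b by case: ltgtP b0 => //; [left|right].
  by case=> // *; nra.
exists b => //; exists (Some (b^-1 *: h)) => /=.
rewrite vecZ mulr1 scalerA mulfV// scale1r dotZl dotZr hh; congr vec; field => //.
Qed.

(** Lets both orientations be treated at once, through the signed curvature alone. *)
Lemma curvature_sphere c (r : {posnum R}) o (b := signed_curvature (OSphere c r o)) :
  b != 0 /\ b^-1 = b * r%:num ^+ 2.
Proof.
have r0 : r%:num != 0 :> R by rewrite gt_eqF.
by rewrite {}/b; case: o => /=; split; rewrite ?oppr_eq0 ?invr_eq0 ?invrN ?invrK//; field.
Qed.

Lemma acc_sphere c (r : {posnum R}) o (b := signed_curvature (OSphere c r o)) :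
  acc_coords (OSphere c r o) = vec (b * dot c c - b^-1) b (b *: c).
Proof. by rewrite -enorm_sqr. Qed.

Lemma bform_acc S : bform (acc_coords S) (acc_coords S) = 1.
Proof.
case: S => [c r o|h m]; last first.
  by rewrite bform_vec unit_vector_dot; field.
rewrite acc_sphere; have [] := curvature_sphere c r o.
move: (signed_curvature _) => b b0 _.
by rewrite bform_vec dotZl dotZr; field.
Qed.

Lemma acc_opp S : acc_coords (osphere_opp S) = - acc_coords S.
Proof.
case: S => [c r [] | h m].
- by rewrite /osphere_opp !acc_sphere vecN /=; congr vec; rewrite ?invrN ?scaleNr//; ring.
- by rewrite /osphere_opp !acc_sphere vecN /=; congr vec;
     rewrite ?invrN ?scaleNr ?opprK//; ring.
- by rewrite [RHS]vecN oppr0 -mulrN.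
Qed.

(** If [b = 0] the row is that of a hyperplane; otherwise [b] gives the radius and the orientation,
    [h / b] is the center, and the normalisation forces the first coordinate. *)
Lemma acc_surj w : bform w w = 1 -> exists S, acc_coords S = w.
Proof.
have [a [b [h ->]]] := vecP w; rewrite bform_vec => e.
have [b0|b0] := eqVneq b 0.
  have hh : enorm h = 1.
    by rewrite /enorm (_ : dot h h = 1) ?sqrtr1//; move: e; rewrite b0; lra.
  exists (OHyperplane (UnitVector hh) (a / 2)).
  by rewrite /acc_coords b0 -/(vec _ _ _) /=; congr vec; field.
have r0 : 0 < `|b|^-1 by rewrite invr_gt0 normr_gt0.
exists (OSphere (b^-1 *: h) (PosNum r0) (if 0 < b then Inward else Outward)).
rewrite acc_sphere.
set b' := signed_curvature _.
have -> : b' = b.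
  rewrite /b'; case: ifP => /= bp; rewrite invrK; first by rewrite gtr0_norm.
  by rewrite ler0_norm ?opprK// leNgt bp.
rewrite scalerA mulfV// scale1r dotZl dotZr; congr vec.
have -> : dot h h = 1 + a * b by move: e; lra.
by field.
Qed.

Lemma image_pt (A : set 'rV[R]_n) y : (@pt R n @` A)%classic (Some y) <-> A y.
Proof. by split=> [[z Az [<-]]|Ay]; [|exists y]. Qed.

(** Up to the factor [- b / 2] this is the power of the point [y] with respect to the sphere. *)
Lemma bform_acc_sphere c (r : {posnum R}) o y :
  bform (acc_coords (OSphere c r o)) (light (Some y)) =
  signed_curvature (OSphere c r o) / 2 * (r%:num ^+ 2 - enorm (y - c) ^+ 2).
Proof.
rewrite acc_sphere bform_vec enorm_sqr dotBB dotZl (dotC c y).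
by have [b0 ->] := curvature_sphere c r o; field.
Qed.

Lemma enorm_ge0 y : 0 <= enorm y.
Proof. exact: sqrtr_ge0. Qed.

Lemma support_bform S x :
  Defs.support S x <-> bform (acc_coords S) (light x) = 0.
Proof.
case: S x => [c r o|h m] [y|].
- rewrite bform_acc_sphere; have [b0 _] := curvature_sphere c r o.
  move: (signed_curvature _) b0 => b b0.
  split=> [/image_pt /= ->|/eqP]; first by rewrite subrr mulr0.
  rewrite !mulf_eq0 (negbTE b0) invr_eq0 pnatr_eq0 /= subr_eq0 => /eqP e.
  apply/image_pt => /=; apply/eqP.
  by rewrite -(@eqrXn2 _ 2) ?enorm_ge0// e.
- rewrite acc_sphere bform_vec dot0r; have [b0 _] := curvature_sphere c r o.
  move: (signed_curvature _) b0 => b b0.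
  by split=> [[]//|/eqP]; move: b0 => /eqP b0 /eqP e; exfalso; apply: b0; lra.
- rewrite bform_vec (dotC h); split=> [[//|/image_pt /=]|e]; first by lra.
  by right; apply/image_pt => /=; lra.
- rewrite bform_vec dot0r; split=> [_|_]; first by lra.
  by left.
Qed.

Lemma ointerior_bform S x :
  ointerior S x <-> 0 < bform (acc_coords S) (light x).
Proof.
have en := enorm_ge0.
case: S x => [c r o|h m] [y|].
- rewrite bform_acc_sphere; have r0 : 0 < r%:num^-1 :> R by rewrite invr_gt0.
  case: o => /=.
    rewrite pmulr_rgt0; last by lra.
    rewrite subr_gt0 ltr_pXn2r ?nnegrE//.
    by split=> [/image_pt//|?]; apply/image_pt.
  rewrite nmulr_rgt0; last by lra.
  rewrite subr_lt0 ltr_pXn2r ?nnegrE//.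
  by split=> [[//|/image_pt//]|?]; right; apply/image_pt.
- rewrite acc_sphere bform_vec dot0r; have r0 : 0 < r%:num^-1 :> R by rewrite invr_gt0.
  case: o => /=; first by split=> [[]//|]; lra.
  by split=> [_|_]; [lra|left].
- rewrite bform_vec (dotC h) /=; split=> [/image_pt /=|e]; first by lra.
  by apply/image_pt => /=; lra.
- by rewrite bform_vec dot0r; split=> [[]//|]; lra.
Qed.

Lemma dot_delta h i : dot h (delta_mx 0 i) = h 0 i.
Proof.
rewrite /dot (bigD1 i)//= big1 ?addr0 => [|j ji]; first by rewrite mxE !eqxx mulr1.
by rewrite mxE (negbTE ji) andbF mulr0.
Qed.

Lemma uvec_inj : injective (@uvec R n).
Proof.
by move=> [h hh] [h' hh'] /= e; subst h'; congr UnitVector; exact: Prop_irrelevance.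
Qed.

(* In dimension 0 all spheres have empty support. *)
Lemma eq_osphere S T : (0 < n)%N -> Defs.support S = Defs.support T ->
  ointerior S = ointerior T -> S = T.
Proof.
move=> n0 eqs eqi.
have es x : Defs.support S x <-> Defs.support T x by rewrite eqs.
have ei x : ointerior S x <-> ointerior T x by rewrite eqi.
case: S T es ei {eqs eqi} => [c r o|h m] [c' r' o'|h' m'] es ei.
- have sph y : enorm (y - c) = r%:num -> enorm (y - c') = r'%:num.
    by move=> e; have [/(_ _)/image_pt H _] := es (Some y); apply: H; apply/image_pt.
  (* The points of the first sphere at distance [r] from [c] along the axis [i] also lie on the
     second. Comparing [s = 1] with [s = -1] gives [c = c'], and then the radii agree. *)
  have key i s : s ^+ 2 = 1 ->
      dot (c - c') (c - c') + 2 * s * r%:num * (c - c') 0 i = r'%:num ^+ 2 - r%:num ^+ 2.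
    move=> s1; have := sph (c + (s * r%:num) *: delta_mx 0 i).
    rewrite addrC addKr => H; rewrite -H ?enorm_sqr; last first.
      apply/eqP; rewrite -(@eqrXn2 _ 2) ?enorm_ge0// enorm_sqr dotZl dotZr.
      by rewrite dot_delta mxE !eqxx mulr1 -expr2 exprMn s1 mul1r.
    rewrite addrAC (dotDD _ (_ *: _)) dotZl !dotZr.
    rewrite !dot_delta [delta_mx _ _ _ _]mxE !eqxx mulr1.
    have -> : r%:num ^+ 2 = s ^+ 2 * r%:num ^+ 2 by rewrite s1 mul1r.
    by move: (dot _ _) => *; ring.
  have cc : c = c'.
    apply/eqP; rewrite -subr_eq0; apply/eqP/rowP => i.
    have := key i 1 (expr1n _ _); have := key i (-1) (etrans (sqrrN 1) (expr1n _ _)).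
    rewrite (_ : (0 : 'rV[R]_n) 0 i = 0) ?[LHS]mxE//.
    move: (dot _ _) ((c - c') 0 i) => d e H1 H2.
    have /eqP : r%:num * e = 0 by lra.
    by rewrite mulf_eq0 gt_eqF//= => /eqP.
  subst c'; have rr : r = r'.
    apply/val_inj => /=; have := key (Ordinal n0) 1 (expr1n _ _).
    rewrite subrr dot0l mxE mulr0 addr0 => /esym/eqP; rewrite subr_eq0.
    by rewrite eqrXn2// => /eqP.
  subst r'; congr OSphere.
  by have := ei None; case: o o' {es ei sph key} => -[]//= [H1 H2];
     [case: H2; [left|..]|case: H1; [left|..]].
- by have [_ /(_ (or_introl erefl)) []] := es None.
- by have [/(_ (or_introl erefl)) []] := es None.
- have hyp y : dot y h = m -> dot y h' = m'.
    move=> e; have [/(_ (or_intror _))[|//|/image_pt//]] := es (Some y).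
    exact/image_pt.
  have hh := unit_vector_dot h; have hh' := unit_vector_dot h'.
  have e0 : m * dot h h' = m'.
    by rewrite -dotZl; apply: hyp; rewrite dotZl hh mulr1.
  (* Apply [hyp] to the orthogonal projection of [y] on the first hyperplane. Taking [y = h'] later
     gives [dot h h' ^+ 2 = 1], and the interiors settle the sign. *)
  have e1 y : dot y h' = dot y h * dot h h'.
    have := hyp (m *: (h : 'rV_n) + (y - dot y h *: (h : 'rV_n))).
    rewrite !dotDl !dotNl !dotZl hh e0 => H.
    by have := H ltac:(ring); lra.
  have hpos : 0 < dot h h'.
    have [H _] := ei (Some ((m + 1) *: (h : 'rV_n))).
    have /H/image_pt/= : ointerior (OHyperplane h m) (Some ((m + 1) *: (h : 'rV_n))).
      by apply/image_pt; rewrite /= dotZl hh; lra.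
    by rewrite dotZl -e0; lra.
  have h1 : dot h h' = 1.
    by have := e1 h'; rewrite hh' (dotC h' h) => e; nra.
  have eh : h = h'.
    apply/uvec_inj/eqP; rewrite -subr_eq0 -dot_eq0 dotBB hh hh' h1; apply/eqP; ring.
  by subst h'; congr OHyperplane; rewrite -e0 h1 mulr1.
Qed.

Definition refl_mx w : 'M[R]_n.+2 := 1%:M - 2 *: (gram R n *m w^T *m w).

Lemma mul_refl_mx u w : u *m refl_mx w = u - (2 * bform u w) *: w.
Proof.
rewrite mulmxDr mulmx1 mulmxN -scalemxAr -scalerA; congr (_ - _ *: _).
rewrite !mulmxA [X in X *m w]mx11_scalar mul_scalar_mx.
by rewrite /bform.
Qed.

Lemma refl_isometry w u v :
  bform w w = 1 -> bform (u *m refl_mx w) (v *m refl_mx w) = bform u v.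
Proof.
move=> w1; rewrite !mul_refl_mx.
rewrite !(bformDl, bformDr, bformNl, bformNr, bformZl, bformZr) w1.
by rewrite (bformC w v); ring.
Qed.

Lemma sqr_radius c (r : {posnum R}) o (b := signed_curvature (OSphere c r o)) :
  r%:num ^+ 2 = b ^- 2.
Proof.
have [b0 e] := curvature_sphere c r o.
by apply: (mulfI b0); rewrite -e -/b; field.
Qed.

(** The factor is |y - c|^2 / r^2 at a point y other than the center, r^2 at the center, r^-2 at
    infinity, and 1 for a hyperplane. *)
Lemma light_mul_refl_mx S x : exists2 k, 0 < k &
  light x *m refl_mx (acc_coords S) = k *: light (reflection S x).
Proof.
rewrite mul_refl_mx; case: S x => [c r o|h m] [y|].
- rewrite bformC bform_acc_sphere acc_sphere [bij_fun _ _]/=.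
  have [b0 _] := curvature_sphere c r o.
  rewrite (sqr_radius c r o) enorm_sqr.
  move: (signed_curvature _) b0 => b b0; case: eqVneq => [->|yc].
    exists (b ^- 2); first by rewrite invr_gt0 exprn_even_gt0.
    rewrite subrr dot0l !vecZ vecN vecD; congr vec; first by field.
      by field.
    by apply/rowP => i; rewrite !mxE; field.
  have d0 : dot (y - c) (y - c) != 0 by rewrite dot_eq0 subr_eq0.
  have dp : 0 < dot (y - c) (y - c) by rewrite lt_def d0 dot_ge0.
  exists (b ^+ 2 * dot (y - c) (y - c)).
    by rewrite mulr_gt0// exprn_even_gt0.
  rewrite !vecZ vecN vecD; congr vec; last first.
  - by apply/rowP => i; rewrite !mxE; field; rewrite b0 d0.
  - by field.
  rewrite (dotDD _ (_ *: _)) dotZl !dotZr.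
  have -> : dot c (y - c) = dot y c - dot c c by rewrite dotDr dotNr dotC.
  move: (dotBB c y) d0; move: (dot (y - c) _) => d dE d0.
  have -> : dot y y = d + 2 * dot y c - dot c c by rewrite dE; ring.
  by field; rewrite b0 d0.
- rewrite bformC acc_sphere bform_vec dot0r [bij_fun _ _]/=.
  have [b0 _] := curvature_sphere c r o.
  move: (signed_curvature _) b0 => b b0.
  exists (b ^+ 2); first by rewrite exprn_even_gt0.
  rewrite !vecZ vecN vecD; congr vec; first by field.
    by field.
  by apply/rowP => i; rewrite !mxE; field.
- have hh := unit_vector_dot h.
  exists 1 => //; rewrite scale1r bform_vec [bij_fun _ _]/= vecZ vecN vecD.
  congr vec; last by apply/rowP => i; rewrite !mxE; field.
    by rewrite dotBB dotZl !dotZr hh; field.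
  by field.
- exists 1 => //; rewrite scale1r bform_vec dot0l [bij_fun _ _]/= vecZ vecN vecD.
  congr vec; last by apply/rowP => i; rewrite !mxE; field.
    by field.
  by field.
Qed.

Lemma light_reflection S x : exists2 k, 0 < k &
  light (reflection S x) *m refl_mx (acc_coords S) = k *: light x.
Proof.
have [k k0 ->] := light_mul_refl_mx S (reflection S x).
by exists k => //; rewrite [X in light X]reflection_funK.
Qed.

End SpheresAsVectors.

(** * The linear isometry of a Moebius transformation *)

Section MobiusAction.
Variables (R : realType) (n : nat).
Implicit Types (u v w : 'rV[R]_n.+2) (V : AutQW R n).
Implicit Types (S T : osphere R n) (x : Rhat R n) (f : bijection (Rhat R n)).

Lemma AutQW_mulE V V' : (V * V')%g = GLmx V *m GLmx V' :> 'M[R]_n.+2.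
Proof. by []. Qed.
Lemma AutQW_invE V : (V^-1)%g = invmx V :> 'M[R]_n.+2.
Proof. by []. Qed.
Lemma AutQW_unit V : GLmx V \in unitmx.
Proof. exact: GLmx_unit. Qed.
Lemma AutQW_inj V V' : GLmx V = GLmx V' -> V = V'.
Proof. by move=> e; apply/val_inj/val_inj. Qed.

(** It is the inverse of [V] that moves the ray of [x] to that of [f x]: with rows acted on from the
    right, this makes the correspondence multiplicative rather than order-reversing. Positivity of
    [k] distinguishes [V] from [- V]. *)
Definition represents f V :=
  forall x, exists2 k, 0 < k & light (f x) *m V = k *: light x.

Lemma represents1 : represents 1%g 1%g.
Proof. by move=> x; exists 1 => //; rewrite mulmx1 scale1r. Qed.

Lemma representsM f g V V' :
  represents f V -> represents g V' -> represents (f * g)%g (V * V')%g.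
Proof.
move=> hf hg x; have [k k0 ke] := hf (g x); have [l l0 le] := hg x.
exists (k * l); first exact: mulr_gt0.
by rewrite AutQW_mulE mulmxA ke -scalemxAl le scalerA.
Qed.

Lemma representsV f V : represents f V -> represents f^-1%g V^-1%g.
Proof.
move=> hf x; have [k k0] := hf (f^-1%g x).
have -> : f (f^-1%g x) = x by exact: (bij_invK f).
move=> ke; exists k^-1; first by rewrite invr_gt0.
rewrite AutQW_invE; apply: (can_inj (mulmxK (AutQW_unit V))).
by rewrite mulmxKV ?AutQW_unit// -scalemxAl ke scalerA mulVf ?gt_eqF// scale1r.
Qed.

Lemma represents_reflection S : exists2 V : AutQW R n,
  represents (reflection S) V & GLmx V = refl_mx (acc_coords S).
Proof.
have [V VE] := isometry_AutQW (fun u v => refl_isometry u v (bform_acc S)).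
by exists V => // x; rewrite VE; exact: light_reflection.
Qed.

Lemma represents_mobius (g : mobius R n) : exists V : AutQW R n, represents g V.
Proof.
have /asboolP := valP g; elim=> {g} [_ [S _ <-]||f g _ [V hV] _ [V' hV']|f _ [V hV]].
- by have [V hV _] := represents_reflection S; exists V.
- by exists 1%g; exact: represents1.
- by exists (V * V')%g; exact: representsM.
- by exists V^-1%g; exact: representsV.
Qed.

(** Let [T] be the sphere with the row on the right. By isometry its product with [light (g x)] is a
    positive multiple of that of [S] with [light x], so [T] has the image support and interior, and
    by [eq_osphere] it is the sphere chosen by [osphere_image]. *)
Lemma represents_acc (g : mobius R n) V S : (0 < n)%N -> represents g V ->
  acc_coords (osphere_image g S) = acc_coords S *m invmx V.
Proof.
move=> n0 hg; have [|T TE] := @acc_surj R n (acc_coords S *m invmx V).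
  by rewrite -AutQW_invE AutQW_bform bform_acc.
have hT x : exists2 k, 0 < k &
    bform (acc_coords T) (light (g x)) = k * bform (acc_coords S) (light x).
  have [k k0 ke] := hg x; exists k => //.
  by rewrite -(AutQW_bform V) TE mulmxKV ?AutQW_unit// ke bformZr.
have image_g (A B : set (Rhat R n)) : (forall x, B (g x) <-> A x) -> B = (g @` A)%classic.
  move=> AB; apply/seteqP; split=> [x|_ [x Ax <-]]; last exact/AB.
  by rewrite -{1}(bij_invK g x) => /AB; exists (bij_inv g x) => //; exact: bij_invK.
have sT : Defs.support T = (g @` Defs.support S)%classic.
  apply: image_g => x; rewrite !support_bform; have [k k0 ->] := hT x.
  split=> [/eqP|->]; last by rewrite mulr0.
  by rewrite mulf_eq0 gt_eqF//= => /eqP.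
have iT : ointerior T = (g @` ointerior S)%classic.
  apply: image_g => x; rewrite !ointerior_bform; have [k k0 ->] := hT x.
  by rewrite pmulr_rgt0.
rewrite -TE; congr acc_coords; rewrite /osphere_image; case: xgetP.
  by move=> U _ [sU iU]; apply: eq_osphere => //; [rewrite sU|rewrite iU].
by move=> /(_ T)[]; split.
Qed.


Lemma represents1_inj f : represents f 1%g -> f = 1%g.
Proof.
move=> hf; apply: bijection_eq => x; have [k _] := hf x.
by rewrite mulmx1 => /esym/light_inj.
Qed.

(** The opposite of a light vector is in the past cone; the second coordinate at the origin shows
    it. *)
Lemma not_represents_opp f V : GLmx V = - 1%:M -> ~ represents f V.
Proof.
move=> VE hf; have [k k0] := hf (Some 0); rewrite VE mulmxN mulmx1.
case: (f _) => [y|] /=; rewrite vecN vecZ => /vec_inj[].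
  by move=> _ e _; move: k0; rewrite -(mulr1 k) -e; lra.
by move=> _ e _; move: k0; rewrite -(mulr1 k) -e; lra.
Qed.


(** * Generation of the time-preserving isometries by sphere reflections *)

Definition mobius_represented V := exists g : mobius R n, represents g V.

(** As [u *m V] and [u] have the same norm, the reflection in their difference [d] exchanges them.
    Vectors fixed by [V] are orthogonal to [d], hence stay fixed; positivity of the norm lets [d] be
    rescaled to the row of a sphere. *)
Lemma exists_reflection V u (d := u *m V - u) : 0 < bform d d ->
  exists V' : AutQW R n, [/\ mobius_represented V',
    u *m (V * V')%g = u & forall v, v *m V = v -> v *m (V * V')%g = v].
Proof.
move=> d0; set q := bform d d in d0.
have s0 : Num.sqrt q != 0 by rewrite gt_eqF// sqrtr_gt0.
have s2 : Num.sqrt q ^+ 2 = q by rewrite sqr_sqrtr// ltW.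
have [|S SE] := @acc_surj R n ((Num.sqrt q)^-1 *: d).
  by rewrite bformZl bformZr -/q -{3}s2; field.
have [V' hV' V'E] := represents_reflection S; exists V'.
have VV' v : v *m (V * V')%g = v *m V - (2 * bform (v *m V) d / q) *: d.
  rewrite AutQW_mulE mulmxA V'E mul_refl_mx SE bformZr scalerA; congr (_ - _ *: _).
  by rewrite -[in RHS]s2; move: s0 (bform _ _); generalize (Num.sqrt q) => z z0 y; field.
split.
- have p : is_mobius (reflection S) by apply/asboolP/generated_mem; exists S.
  by exists (MkMobius p).
- rewrite VV'; have -> : 2 * bform (u *m V) d / q = 1.
    have qE : q = 2 * bform (u *m V) d.
      rewrite /q /d !(bformDl, bformDr, bformNl, bformNr) AutQW_bform (bformC u); ring.
    by rewrite -qE divff// gt_eqF.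
  by rewrite scale1r /d opprB addrC subrK.
- move=> v vV; rewrite VV' vV.
  have -> : bform v d = 0.
    by rewrite /d bformDr bformNr -{1}vV AutQW_bform subrr.
  by rewrite mulr0 mul0r scale0r subr0.
Qed.

Lemma mobius_representedM V V' : mobius_represented V' ->
  mobius_represented (V * V')%g -> mobius_represented V.
Proof.
move=> [g hg] [f hf]; exists (f * g^-1)%g.
rewrite -(mulgK V' V); apply: representsM => //; exact: representsV.
Qed.

Let t := vec 1 1 0 : 'rV[R]_n.+2.

(** The form is positive definite on the orthogonal complement of [t], which contains every
    difference [u *m V - u]; so each basis vector in turn can be brought back by a reflection. *)
Lemma fixes_time_represented V : t *m V = t -> mobius_represented V.
Proof.
move=> tV.
pose fixk k V := t *m V = t /\
  forall i : 'I_n.+2, (i < k)%N -> delta_mx 0 i *m V = delta_mx 0 i :> 'rV_n.+2.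
(* Here [k] counts the basis vectors not yet known to be fixed. *)
suff H k : (k <= n.+2)%N -> forall V, fixk (n.+2 - k)%N V -> mobius_represented V.
  by apply: (H n.+2 (leqnn _)); rewrite subnn.
elim: k => [|k IH] kn {tV}V [tV fV].

  rewrite subn0 in fV; have -> : V = 1%g.
    apply/AutQW_inj/row_matrixP => i; rewrite !rowE mulmx1; exact: fV.
  by exists 1%g; exact: represents1.
have jlt : (n.+2 - k.+1 < n.+2)%N by rewrite ltn_subrL.
pose j := Ordinal jlt; set u : 'rV[R]_n.+2 := delta_mx 0 j.
have nk : (n.+2 - k = (n.+2 - k.+1).+1)%N by rewrite subnSK.
have extend (W : AutQW R n) : t *m W = t -> u *m W = u ->
    (forall v, v *m V = v -> v *m W = v) -> mobius_represented W.
  move=> tW uW VW; apply: IH; first exact: ltnW.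
  split=> // i; rewrite nk ltnS leq_eqVlt => /orP[/eqP ij|ij]; last exact/VW/fV.
  by have -> : i = j by exact/val_inj.
have [uV|uV] := eqVneq (u *m V) u; first by apply: extend.
have d0 : 0 < bform (u *m V - u) (u *m V - u).
  have : bform (u *m V - u) t = 0.
    by rewrite bformDl bformNl -{1}tV AutQW_bform subrr.
  have : u *m V - u != 0 by rewrite subr_eq0.
  have [a [b [h ->]]] := vecP (u *m V - u).
  (* Orthogonality to [t] reads [a + b = 0], so the norm becomes |h|^2 + b^2. *)
  rewrite !bform_vec dot0r => h0 e; have -> : a = - b by lra.
  have := dot_ge0 h; rewrite le_eqVlt => /orP[|hp]; last by have := sqr_ge0 b; nra.
  rewrite eq_sym dot_eq0 => /eqP hE; rewrite hE dot0l.
  have b0 : b != 0.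
    apply: contraNneq h0 => b0; rewrite hE b0 (_ : a = 0); last by lra.
    by rewrite vec0.
  have : 0 < b ^+ 2 by rewrite exprn_even_gt0.
  nra.
have [V' [rV' uV' VV']] := exists_reflection d0.
by apply: (mobius_representedM rV'); apply: extend => //; exact: VV'.
Qed.

(** The difference [t *m V - t] has norm [a + b - 2]. As [a * b = 1 + dot h h] and [0 < a + b], this
    is positive unless [t] is fixed, so at most one reflection brings [t] back. *)
Lemma positive_represented V a b h :
  t *m V = vec a b h -> 0 < a + b -> mobius_represented V.
Proof.
move=> e ab; have [tV|tV] := eqVneq (t *m V) t; first exact: fixes_time_represented.
have hh : dot h h = a * b - 1.
  have := AutQW_bform V t t; rewrite e !bform_vec dot0l; lra.
have h0 := dot_ge0 h.
have d0 : 0 < bform (t *m V - t) (t *m V - t).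
  rewrite e vecN vecD bform_vec subr0 hh.
  suff : a + b != 2 by have := sqr_ge0 (a - b); nra.
  apply: contraNneq tV => ab2; have aE : a = 2 - b by lra.
  have /eqP : (b - 1) ^+ 2 = 0 by have := sqr_ge0 (b - 1); nra.
  rewrite sqrf_eq0 subr_eq0 => /eqP b1.
  move: hh; rewrite aE b1 => /eqP; rewrite (_ : _ * _ - _ = 0) ?dot_eq0; last by ring.
  by move=> /eqP h00; rewrite e aE b1 h00; apply/eqP; congr vec; ring.
have [V' [rV' uV' VV']] := exists_reflection d0.
by apply: (mobius_representedM rV'); exact: fixes_time_represented.
Qed.

Fact pm_AutQW_subproof (e : pmI R n) : preserves_QW (pmI_GL e).
Proof.
apply/eqP; have [] := orP (valP e) => /eqP ->; first by rewrite trmx1 mul1mx mulmx1.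
have -> : (- 1%:M)^T = - 1%:M :> 'M[R]_n.+2.
  by apply/matrixP => i j; rewrite !mxE eq_sym.
by rewrite mulNmx mul1mx mulmxN mulmx1 opprK.
Qed.

Definition pm_AutQW (e : pmI R n) : AutQW R n := MkAutQW (pm_AutQW_subproof e).

Lemma pm_AutQWM e e' : pm_AutQW (e * e')%g = (pm_AutQW e * pm_AutQW e')%g.
Proof. by apply/AutQW_inj. Qed.

Lemma pmI_case (e : pmI R n) : e = 1%g \/ e = negI.
Proof. by have [] := orP (valP e) => /eqP E; [left|right]; apply/val_inj/val_inj. Qed.

Lemma pm_AutQWC e V : (pm_AutQW e * V = V * pm_AutQW e)%g.
Proof.
apply/AutQW_inj; rewrite !AutQW_mulE /=.
by have [] := orP (valP e) => /eqP ->; rewrite ?mulNmx ?mulmxN mul1mx mulmx1.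
Qed.

(** The image (a, b, h) of [t] satisfies [a * b = 1 + dot h h], so [a + b] is nonzero; if it is
    negative, a factor [negI] changes its sign. *)
Lemma AutQW_mobius_pm V :
  exists2 V', mobius_represented V' & exists e, V = (V' * pm_AutQW e)%g.
Proof.
have [a [b [h e]]] := vecP (t *m V).
have := AutQW_bform V t t; rewrite e !bform_vec dot0l => E.
have [ab|ab|ab] := ltgtP (a + b) 0; last first.
- have bE : b = - a by lra.
  by move: E (dot_ge0 h) (sqr_ge0 a); rewrite bE {e} => *; exfalso; nra.
- exists V; first exact: positive_represented e ab.
  by exists 1%g; apply/AutQW_inj; rewrite AutQW_mulE mulmx1.
- exists (V * pm_AutQW negI)%g.
    apply: (@positive_represented _ (- a) (- b) (- h)); last by lra.
    by rewrite AutQW_mulE mulmxA mulmxN mulmx1 e vecN.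
  by exists negI; apply/AutQW_inj; rewrite !AutQW_mulE !mulmxN !mulmx1 opprK.
Qed.

End MobiusAction.

(** * A Descartes configuration with invertible coordinate matrix *)

Section DescartesConfiguration.
Variables (R : realType) (n : nat).
Hypothesis n_ge2 : (2 <= n)%N.

(** The value -1 is that of tangent spheres with disjoint interiors; the sum of their rows is then
    null and spans the ray of the point of tangency. *)
Definition descartes_gram (D : 'I_n.+2 -> osphere R n) :=
  forall i j, bform (acc_coords (D i)) (acc_coords (D j)) = if i == j then 1 else -1.

(** The Gram matrix [2%:M - J] of the rows has as inverse half of the Descartes form I - J / n. *)
Lemma descartes_gram_unit D : descartes_gram D -> W D \in unitmx.
Proof.
move=> hD; have n0 : n%:R != 0 :> R by rewrite pnatr_eq0 -lt0n (leq_trans _ n_ge2).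
pose J := const_mx 1 : 'M[R]_n.+2.
have JJ : J *m J = n.+2%:R *: J.
  apply/matrixP => i j; rewrite !mxE (eq_bigr (fun=> 1)) ?sumr_const ?card_ord ?mulr1//.
  by move=> k _; rewrite !mxE mulr1.
have G : W D *m gram R n *m (W D)^T = 2%:M - J.
  apply/matrixP => i j; have := hD i j.
  rewrite -[acc_coords (D i)](rowK (fun j => acc_coords (D j))).
  rewrite -[acc_coords (D j)](rowK (fun j => acc_coords (D j))) -/(W D).
  rewrite /bform !rowE trmx_mul trmx_delta !mulmxA -(mulmxA _ (W D)) -(mulmxA _ (_ *m _)).
  rewrite -rowE -colE !mxE => ->.
  by case: eqP => _; rewrite ?mulr1n ?mulr0n; ring.
have : (2%:M - J) *m (2^-1 *: (1%:M - n%:R^-1 *: J)) = 1%:M.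
  have nE : n.+2%:R = n%:R + 2 :> R by rewrite -addn2 natrD.
  rewrite -scalemxAr mulmxBl !mulmxBr !mulmx1 -!scalemxAr JJ mul_scalar_mx scalerA nE.
  apply/matrixP => i j; rewrite !mxE.
  by case: (i == j); rewrite ?mulr1n ?mulr0n; field.
by move=> /mulmx1_unit[]; rewrite -G -mulmxA unitmx_mul => /andP[].
Qed.

(* Pairing with the time vector [vec 1 1 0] is negative on the future half of the
   light cone, so all the points of tangency have positive multiples of
   [light x] as representatives. *)
Lemma descartes_gram_oriented D : descartes_gram D ->
  (forall i, bform (acc_coords (D i)) (vec 1 1 0) < 0) -> oriented_descartes D.
Proof.
move=> hD time.
have tangency i j : i != j -> exists2 k, 0 < k &
    exists x, acc_coords (D i) + acc_coords (D j) = k *: light x.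
  move=> ij; have [a [b [h e]]] := vecP (acc_coords (D i) + acc_coords (D j)).
  rewrite e; apply: lightlike_light.
    have : bform (vec a b h) (vec a b h) = 0.
      rewrite -e !(bformDl, bformDr) !hD !eqxx (negbTE ij) eq_sym (negbTE ij); ring.
    by rewrite bform_vec => H; lra.
  have : bform (vec a b h) (vec 1 1 0) < 0.
    by rewrite -e bformDl; have := time i; have := time j; lra.
  by rewrite bform_vec dot0r; lra.
have tangent i j k x : i != j -> 0 < k ->
    acc_coords (D i) + acc_coords (D j) = k *: light x -> tangent_at (D i) (D j) x.
  move=> ij k0 e; apply/seteqP; split=> [y|_ ->].
    move=> [/support_bform iy /support_bform jy]; apply: contrapT => /nesym xy.
    have := light_bform_lt0 xy; have : k * bform (light x) (light y) = 0.
      by rewrite -bformZl -e bformDl iy jy addr0.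
    by move=> /eqP; rewrite mulf_eq0 gt_eqF//= => /eqP ->; rewrite ltxx.
  split; apply/support_bform.
    have : k * bform (acc_coords (D i)) (light x) = 0.
      by rewrite -bformZr -e bformDr !hD eqxx (negbTE ij) subrr.
    by move=> /eqP; rewrite mulf_eq0 gt_eqF//= => /eqP.
  have : k * bform (acc_coords (D j)) (light x) = 0.
    by rewrite -bformZr -e bformDr !hD eqxx eq_sym (negbTE ij) addNr.
  by move=> /eqP; rewrite mulf_eq0 gt_eqF//= => /eqP.
split.
- by move=> i j ij; have [k k0 [x e]] := tangency i j ij; exists x; exact: tangent e.
- move=> i j k l p ij kl.
  have nij : i != j by rewrite neq_ltn ij.
  have nkl : k != l by rewrite neq_ltn kl.
  have [a a0 [x ex]] := tangency i j nij.
  have [b b0 [y ey]] := tangency k l nkl.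
  rewrite /tangent_at (tangent _ _ _ _ nij a0 ex) (tangent _ _ _ _ nkl b0 ey).
  move=> /seteqP[/(_ _ erefl) xp _] /seteqP[/(_ _ erefl) yp _].
  (* Equal points of tangency make the two sums of rows orthogonal, whereas their product is -2 if
     the pairs share one sphere and -4 if they share none. The crossed case [i = l], [j = k]
     contradicts the order of the indices. *)
  have : bform (a *: light x) (b *: light y) = 0.
    by rewrite bformZl bformZr xp yp light_bform !mulr0.
  rewrite -ex -ey !(bformDl, bformDr) !hD.
  have [eik|ik] := eqVneq i k; have [ejl|jl] := eqVneq j l.
  + by rewrite eik ejl.
  + subst k; rewrite (eq_sym j i) (negbTE nij) (negbTE nkl) => /eqP.
    by rewrite lt_eqF//; lra.
  + subst l; rewrite (eq_sym j k) (negbTE nij) (negbTE nkl) => /eqP.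
    by rewrite lt_eqF//; lra.
  + have [il|_] := eqVneq i l; have [jk|_] := eqVneq j k; last 3 first.
    1-3: by move=> /eqP; rewrite lt_eqF//; lra.
    by move: ij; rewrite il jk ltnNge ltnW.
(* A common interior point would have a positive product with the point of tangency, but light
   vectors never do. *)
- left=> i j ij; rewrite -subset0 => x [/ointerior_bform ix /ointerior_bform jx].
  have [k k0 [y e]] := tangency i j ij.
  have : 0 < k * bform (light y) (light x) by rewrite -bformZl -e bformDl addr_gt0.
  rewrite pmulr_rgt0//; have [->|yx] := pselect (y = x).
    by rewrite light_bform ltxx.
  by have := light_bform_lt0 yx; lra.
Qed.

Lemma dot_const (k l : R) : dot (const_mx k : 'rV_n) (const_mx l) = n%:R * (k * l).
Proof.
rewrite /dot (eq_bigr (fun=> k * l)) => [|i _]; last by rewrite !mxE.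
by rewrite sumr_const card_ord mulr_natl.
Qed.

(* In a Lorentz basis with time vector [t = vec 1 1 0] and orthonormal space
   vectors [e_0 = vec 1 (-1) 0], [e_j = vec 0 0 'e_j], these are [t + sqrt 2 e_j]
   and [(2 g + 1) t + sqrt 2 g (e_0 + ... + e_n)]; the quadratic equation
   [(n - 1) g^2 - 2 g = 1] normalises the last one. *)
Lemma descartes_exists : exists D : 'I_n.+2 -> osphere R n,
  oriented_descartes D /\ W D \in unitmx.
Proof.
pose m := Num.sqrt n%:R : R; pose s := Num.sqrt 2 : R; pose g := - (m + 1)^-1.
have s2 : s * s = 2 by rewrite -expr2 sqr_sqrtr.
have m2 : m * m = n%:R by rewrite -expr2 sqr_sqrtr.
have m0 : 0 <= m by exact: sqrtr_ge0.
have nR : 2 <= n%:R :> R by rewrite ler_nat.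
have m1 : 1 < m by nra.
have gE : (n%:R - 1) * (g * g) - 2 * g = 1 by rewrite /g -m2; field; lra.
(* The last vector has product [- (2 * g + 1)] with the time vector, which must be negative. *)
have g1 : 0 < 2 * g + 1.
  have -> : 2 * g + 1 = (m - 1) / (m + 1) by rewrite /g; field; lra.
  by apply: divr_gt0; lra.
(* [inl 0] is the exceptional vector, [inl 1] the one along e_0, and [inr k] the one along the basis
   vector of index [k]. *)
pose w (z : 'I_2 + 'I_n) := match z with
  | inl i => if i == 0 then vec (2 * g + 1 + s * g) (2 * g + 1 - s * g) (const_mx (s * g))
             else vec (1 + s) (1 - s) 0
  | inr k => vec 1 1 (s *: delta_mx 0 k) : 'rV[R]_n.+2
  end.
have wG z z' : bform (w z) (w z') = if z == z' then 1 else -1.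
  have sg : n%:R * (s * g * (s * g)) = 2 * (n%:R * (g * g)) by rewrite -s2; ring.
  have ngg : n%:R * (g * g) = g * g + 2 * g + 1 by lra.
  have e2 (i : 'I_2) : i = 0 \/ i = 1.
    by case: i => [[|[|//]] p]; [left|right]; exact/val_inj.
  have dd (k : 'I_n) : dot (const_mx (s * g) : 'rV_n) (delta_mx 0 k) = s * g.
    by rewrite dot_delta mxE.
  have C1 : s * g * s = 2 * g by rewrite mulrAC s2.
  have C2 : s * g * (s * g) = 2 * (g * g) by rewrite mulrACA s2.
  case: z z' => [i|k] [j|l] /=; rewrite ?(inj_eq (@inl_inj _ _)) ?(inj_eq (@inr_inj _ _)).
  - have [-> | ->] := e2 i; have [-> | ->] := e2 j => /=;
      rewrite bform_vec ?dot0l ?dot0r ?dot_const ?sg ?ngg; nra.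
  - have [-> | ->] := e2 i => /=; rewrite bform_vec ?dot0l ?dotZr ?dd; nra.
  - have [-> | ->] := e2 j => /=;
      rewrite bform_vec ?dot0r ?dotZl ?(dotC (delta_mx _ _)) ?dd; nra.
  - rewrite bform_vec dotZl dotZr dot_delta mxE eqxx (eq_sym k l) /= mulrA s2.
    by case: (l == k); rewrite ?mulr1n ?mulr0n; lra.
have wt z : bform (w z) (vec 1 1 0) < 0.
  by case: z => [i|k] /=; [case: ifP => _|]; rewrite bform_vec dot0r; lra.
have /boolp.choice[D DE] : forall i : 'I_n.+2, exists S : osphere R n,
    acc_coords S = w (@fintype.split 2 n i).
  by move=> i; apply: acc_surj; rewrite wG eqxx.
have hD : descartes_gram D.
  by move=> i j; rewrite !DE wG (inj_eq (can_inj (@splitK 2 n))).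
exists D; split; last exact: descartes_gram_unit.
by apply: descartes_gram_oriented => // i; rewrite DE.
Qed.

End DescartesConfiguration.

(** * The isomorphism *)

Section MobiusToAut.
Variables (R : realType) (n : nat).
Hypothesis n_ge2 : (2 <= n)%N.

Lemma W_image (g : mobius R n) V (D : 'I_n.+2 -> osphere R n) :
  represents g V -> W (osphere_image g \o D) = W D *m invmx V.
Proof.
move=> gV; apply/row_matrixP => i; rewrite row_mul !rowK.
by apply: represents_acc => //; exact: ltnW.
Qed.

Lemma W_opp (D : 'I_n.+2 -> osphere R n) : W (@osphere_opp R n \o D) = - W D.
Proof. by apply/row_matrixP => i; rewrite linearN /= !rowK acc_opp. Qed.

Lemma AutQW_invmx_inj (V V' : AutQW R n) : invmx V = invmx V' -> V = V'.
Proof. by move=> e; apply/AutQW_inj; rewrite -(invmxK V) e invmxK. Qed.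

(** Both inverses send the same invertible [W D] to the matrix of the image configuration. Hence the
    choice in [mobius_mx] is forced, which makes it multiplicative. *)
Lemma represents_unique (g : mobius R n) V V' :
  represents g V -> represents g V' -> V = V'.
Proof.
move=> gV gV'; have [D [_ uD]] := @descartes_exists R n n_ge2.
by apply/AutQW_invmx_inj/(can_inj (mulKmx uD)); rewrite -(W_image D gV) -(W_image D gV').
Qed.

Lemma invmx_negI : invmx (pm_AutQW (@negI R n)) = - 1%:M.
Proof.
have -> : pm_AutQW negI = ((pm_AutQW (@negI R n))^-1)%g.
  apply/eqP; rewrite -mulg_eq1; apply/eqP/AutQW_inj.
  by rewrite AutQW_mulE mulNmx mul1mx opprK.
by rewrite AutQW_invE invmxK.
Qed.

Definition mobius_mx (g : mobius R n) : AutQW R n := sval (cid (represents_mobius g)).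

Lemma mobius_mxP (g : mobius R n) : represents g (mobius_mx g).
Proof. exact: svalP (cid (represents_mobius g)). Qed.

Lemma mobius_mxM g g' : mobius_mx (g * g')%g = (mobius_mx g * mobius_mx g')%g.
Proof.
apply: (@represents_unique (g * g')%g); first exact: mobius_mxP.
by apply: representsM; exact: mobius_mxP.
Qed.

Definition GMstar_mx (x : GMstar R n) : AutQW R n :=
  (mobius_mx x.1 * pm_AutQW x.2)%g.

Lemma GMstar_mxM : {morph GMstar_mx : x y / (x * y)%g >-> (x * y)%g}.
Proof.
move=> [g e] [g' e']; rewrite /GMstar_mx /= mobius_mxM pm_AutQWM.
by rewrite !mulgA; congr (_ * _)%g; rewrite -!mulgA pm_AutQWC.
Qed.

(** If two images agree, plus or minus the identity represents the quotient of the Moebius parts.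
    The minus sign would reverse time, and the plus sign makes the quotient trivial. *)
Lemma GMstar_mx_inj : injective GMstar_mx.
Proof.
move=> [g e] [g' e']; rewrite /GMstar_mx /= => H.
have E : ((mobius_mx g')^-1 * mobius_mx g = pm_AutQW (e' * e^-1))%g.
  apply: (mulgI (mobius_mx g')); rewrite mulVKg.
  by apply: (mulIg (pm_AutQW e)); rewrite -mulgA -pm_AutQWM mulgVK.
have r : represents ((g' : bijection _)^-1 * g)%g (pm_AutQW (e' * e^-1)%g).
  rewrite -E; apply: representsM; last exact: mobius_mxP.
  by apply: representsV; exact: mobius_mxP.
have [e1|eN] := pmI_case (e' * e^-1)%g; last first.
  by case: (not_represents_opp _ r); rewrite eN.
have -> : e' = e by apply: (mulIg e^-1%g); rewrite e1 mulgV.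
congr (_, _); apply/val_inj/(mulgI (mobius_bij g')^-1%g); rewrite mulVg.
apply: represents1_inj; move: r; rewrite e1.
by congr represents; exact/AutQW_inj.
Qed.

Lemma GMstar_mx_surj V : exists x, GMstar_mx x = V.
Proof.
have [V' [g gV'] [e ->]] := AutQW_mobius_pm V.
by exists (g, e); rewrite /GMstar_mx /= (represents_unique gV' (mobius_mxP g)).
Qed.

Lemma GMstar_mx_bij : bijective GMstar_mx.
Proof.
have [f fK] := boolp.choice GMstar_mx_surj.
by exists f => // x; apply: GMstar_mx_inj; rewrite fK.
Qed.

End MobiusToAut.

Theorem theorem9p1 (R : realType) (n : nat) (n_ge2 : (2 <= n)%N) :
  exists! pi : GMstar R n -> AutQW R n,
    [/\ bijective pi,
        {morph pi : x y / (x * y)%g >-> (x * y)%g},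
        forall (g : mobius R n) (D : 'I_n.+2 -> osphere R n),
          oriented_descartes D ->
          W (osphere_image g \o D) = W D *m invmx (pi (g, 1%g))
      & forall D : 'I_n.+2 -> osphere R n,
          oriented_descartes D ->
          W (@osphere_opp R n \o D) = W D *m invmx (pi (1%g, negI)) /\
          W D *m invmx (pi (1%g, negI)) = - W D].
Proof.
have mx1 (g : mobius R n) : represents g (GMstar_mx (g, 1%g) : AutQW R n).
  have -> : GMstar_mx (g, 1%g) = mobius_mx g; last exact: mobius_mxP.
  by apply/AutQW_inj; rewrite AutQW_mulE mulmx1.
have mxN : GMstar_mx (1%g, negI) = pm_AutQW (@negI R n).
  rewrite /GMstar_mx /= (represents_unique n_ge2 (mobius_mxP 1%g) (@represents1 R n)).
  by apply/AutQW_inj; rewrite AutQW_mulE mul1mx.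
exists (@GMstar_mx R n); split.
  split; [exact: GMstar_mx_bij|exact: GMstar_mxM|..].
  - by move=> g D _; exact/W_image/mx1.
  - by move=> D _; rewrite mxN invmx_negI mulmxN mulmx1 W_opp.
move=> pi [_ piM piW piN]; have [D [hD uD]] := @descartes_exists R n n_ge2.
apply/funext => -[g e].
(* A morphism is determined by its values on the two factors, and cancelling the invertible [W D] in
   the two coordinate identities determines these. *)
have decomp (f : GMstar R n -> AutQW R n) : {morph f : x y / (x * y)%g >-> (x * y)%g} ->
    f (g, e) = (f (g, 1%g) * f (1%g, e))%g.
  by move=> <-; congr f; rewrite -{1}[g]mulg1 -{1}[e]mul1g.
rewrite (decomp _ (GMstar_mxM n_ge2)) (decomp _ piM); congr (_ * _)%g.
  apply/AutQW_invmx_inj/(can_inj (mulKmx uD)).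
  by rewrite -(W_image n_ge2 D (mx1 g)) piW.
have [->|->] := pmI_case e.
  have f1 (f : GMstar R n -> AutQW R n) :
      {morph f : x y / (x * y)%g >-> (x * y)%g} -> f 1%g = 1%g.
    by move=> fM; apply: (mulgI (f 1%g)); rewrite -fM !mulg1.
  by rewrite !f1//; exact: GMstar_mxM.
apply/AutQW_invmx_inj/(can_inj (mulKmx uD)).
by rewrite (piN D hD).2 mxN invmx_negI mulmxN mulmx1.
Qed.
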